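(* If $m,n$ are integers with $3 \leq m \leq n$ and $m \equiv 2\pmod{3}$, then $\mathrm{dom}_t(P_m \Box P_n) \leq \frac{(m+1)n}{3}+\frac{2(m+1)}{3}$.
   Context: An orientation of a (finite simple) graph $G$ is a digraph obtained by directing each edge $uv$ of $G$ in exactly one of the two directions $(u,v)$ or $(v,u)$. The orientation is valid if every vertex has in-degree at least $1$. A set $S\subseteq V(D)$ is a total dominating set of a digraph $D$ if every vertex of $D$ (including those in $S$) has an in-neighbor in $S$; $\gamma_t(D)$ is the minimum cardinality of a total dominating set of $D$. For a graph $G$ in which every component contains a cycle (equivalently, $G$ has a valid orientation), $\mathrm{dom}_t(G)$ is the minimum of $\gamma_t(D)$ over all valid orientations $D$ of $G$. $P_m$ is the path on $m$ vertices, and $G\Box H$ is the Cartesian product: vertex set $V(G)\times V(H)$, with $(g,h)$ adjacent to $(g',h')$ iff either $g=g'$ and $hh'\in E(H)$, or $gg'\in E(G)$ and $h=h'$. *)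

(* Defs.v *)
From HB Require Import structures.
From mathcomp Require Import all_boot all_order all_algebra.

Set Implicit Arguments.
Unset Strict Implicit.
Unset Printing Implicit Defensive.

Record sgraph := SGraph {
  vertex :> finType;
  adj : rel vertex;
  adj_sym : symmetric adj;
  adj_irr : irreflexive adj }.

Definition digraph (T : finType) := {set T * T}.

Definition orientation (G : sgraph) (D : digraph G) : bool :=
  [forall u, forall v,
     if adj u v then ((u, v) \in D) (+) ((v, u) \in D) else (u, v) \notin D].

Definition indegree (T : finType) (D : digraph T) (v : T) : nat :=
  #|[set u | (u, v) \in D]|.

Definition valid_orientation (G : sgraph) (D : digraph G) : bool :=
  orientation D && [forall v, 0 < indegree D v].

Definition total_dominating (T : finType) (D : digraph T) (S : {set T}) : bool :=
  [forall v, exists u in S, (u, v) \in D].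

(* The default value #|T| is never smaller than the minimum when a total
   dominating set exists; it is only a junk value when there is none. *)
Definition gamma_t (T : finType) (D : digraph T) : nat :=
  \big[minn/#|T|]_(S : {set T} | total_dominating D S) #|S|.

(* Likewise, gamma_t D <= #|G|, so the default value only matters when G has
   no valid orientation. *)
Definition dom_t (G : sgraph) : nat :=
  \big[minn/#|G|]_(D : digraph G | valid_orientation D) gamma_t D.

Definition path_adj (m : nat) : rel 'I_m :=
  fun i j => (i.+1 == j :> nat) || (j.+1 == i :> nat).

Fact path_adj_sym m : symmetric (@path_adj m).
Proof. by move=> i j; rewrite /path_adj orbC. Qed.

Fact path_adj_irr m : irreflexive (@path_adj m).
Proof. by move=> i; rewrite /path_adj orbb gtn_eqF. Qed.

Definition path_graph (m : nat) : sgraph :=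
  SGraph (@path_adj_sym m) (@path_adj_irr m).

Definition cart_adj (G H : sgraph) : rel (G * H) :=
  fun x y => (x.1 == y.1) && adj x.2 y.2 || adj x.1 y.1 && (x.2 == y.2).

Fact cart_adj_sym G H : symmetric (@cart_adj G H).
Proof.
by move=> x y; rewrite /cart_adj [x.1 == _]eq_sym [x.2 == _]eq_sym !(adj_sym x.1) !(adj_sym x.2).
Qed.

Fact cart_adj_irr G H : irreflexive (@cart_adj G H).
Proof. by move=> x; rewrite /cart_adj !adj_irr andbF. Qed.

Definition cart_prod (G H : sgraph) : sgraph :=
  SGraph (@cart_adj_sym G H) (@cart_adj_irr G H).

(* Main.v *)
Require Import Defs.
From mathcomp Require Import all_boot all_order all_algebra.
From mathcomp Require Import zify ring.

Import GRing.Theory Num.Theory.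

(** Choosing for every vertex [v] one dominating in-neighbour [f v] turns the
    problem into a combinatorial one: a map [f] moving every vertex to a
    neighbour comes from a valid orientation as soon as it never swaps two
    vertices, since the edges [f v -> v] then get no contradictory directions
    and all other edges can be directed at will.  The image of [f] is totally
    dominating, so it bounds [dom_t] ([dom_t_le_parent]).

    In the grid [P_m [] P_n] with [m = 3k + 2], the rows [1, 4, .., 3k + 1] are
    taken entirely: every other row is next to one of these [k + 1] rows, so
    only the vertices of the chosen rows still need in-neighbours.  Directing such
    a row away from its left end serves all of it except that end; the end is
    served by a directed 4-cycle through the two leftmost vertices of the row
    and the two vertices in the row just before it.  This costs [n + 2] vertices
    for each of the [k + 1] rows, which is the bound
    [(k + 1) (n + 2) = (m + 1) n / 3 + 2 (m + 1) / 3]. *)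

(** * Orientations from parent maps *)

Lemma bigminn_le_cond (I : finType) (P : pred I) (F : I -> nat) x0 i :
  P i -> \big[minn/x0]_(j | P j) F j <= F i.
Proof. exact: (@Order.TotalTheory.bigmin_le_cond _ nat). Qed.

Section ParentMap.

Variables (G : sgraph) (f : G -> G).

(** The enumeration rank serves only to direct the edges not used by [f]. *)
Definition parent_digraph : digraph G :=
  [set e | adj e.1 e.2 &&
     ((e.1 == f e.2) ||
      (e.2 != f e.1) && (enum_rank e.1 < enum_rank e.2))].

Hypothesis adj_f : forall v, adj (f v) v.
Hypothesis f_no_swap : forall v, f (f v) != v.

Lemma parent_arc v : (f v, v) \in parent_digraph.
Proof. by rewrite inE /= adj_f eqxx. Qed.

Lemma parent_digraph_valid : valid_orientation parent_digraph.
Proof.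
apply/andP; split; last first.
  by apply/forallP=> v; apply/card_gt0P; exists (f v); rewrite inE parent_arc.
apply/forallP=> u; apply/forallP=> v; case: ifPn => [uv|/negbTE Nuv]; last first.
  by rewrite inE /= Nuv.
rewrite !inE /= uv adj_sym uv /=.
have [->|u_fv] := eqVneq u (f v).
  by rewrite [v == _]eq_sym (negbTE (f_no_swap v)).
have [//|v_fu] := eqVneq v (f u).
have rank_uv : enum_rank u != enum_rank v :> nat.
  apply: contraTneq uv => /ord_inj/enum_rank_inj ->.
  by rewrite adj_irr.
by case: ltngtP rank_uv.
Qed.

Lemma dom_t_le_parent : dom_t G <= #|f @: setT|.
Proof.
apply: leq_trans (bigminn_le_cond _ _ _ _ _ parent_digraph_valid) _.
apply: bigminn_le_cond; apply/forallP=> v; apply/exists_inP.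
by exists (f v); rewrite ?imset_f ?parent_arc.
Qed.

End ParentMap.

(** * The parent map on the grid *)

(** Coordinates are (row, position in the row).  For rows [a = 3j + 1] the
    directed 4-cycle is (a,0) -> (a,1) -> (a-1,1) -> (a-1,0) -> (a,0). *)
Definition grid_parent (a t : nat) : nat * nat :=
  match a %% 3, t with
  | 0, 0 => (a, 1)
  | 0, _ => (a.+1, t)
  | 1, 0 => (a.-1, 0)
  | 1, t'.+1 => (a, t')
  | _, _ => (a.-1, t)
  end.

(** The last row [3k + 1] is itself a fully taken row, so that the parents of
    row [3k] do not leave the grid. *)
Lemma grid_parent_lt k n a t : a < (3 * k).+2 -> t < n.+2 ->
  (grid_parent a t).1 < (3 * k).+2 /\ (grid_parent a t).2 < n.+2.
Proof.
rewrite /grid_parent.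
by case r: (a %% 3) => [|[|r']]; case: t => [|t'] /=; lia.
Qed.

Lemma grid_parent_adj a t (p := grid_parent a t) :
  (p.1 == a) && ((p.2.+1 == t) || (t.+1 == p.2)) ||
  ((p.1.+1 == a) || (a.+1 == p.1)) && (p.2 == t).
Proof.
rewrite /p /grid_parent.
by case r: (a %% 3) => [|[|r']]; case: t p => [|t'] p /=; lia.
Qed.

Lemma grid_parent_no_swap a t (p := grid_parent a t) :
  grid_parent p.1 p.2 != (a, t).
Proof.
apply/eqP; rewrite /p /grid_parent.
case r: (a %% 3) => [|[|r']]; case: t p => [|[|t']] p /=.
all: case r1: (_ %% 3) => [|[|r1']] E; move: (congr1 fst E) (congr1 snd E).
all: by rewrite /=; lia.
Qed.

(** Enumerating the dominators over a product of intervals (row [3j + 1] by the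
    first [n] values of [s], the two extra cycle vertices in row [3j] by the
    next two) bounds their number by [(k + 1) (n + 2)] without counting. *)
Definition grid_dominator (n j s : nat) : nat * nat :=
  if s < n then ((3 * j).+1, s) else (3 * j, s - n).

Lemma grid_parent_dominator k n a t : a < (3 * k).+2 -> t < n.+2 ->
  exists j s, [/\ j < k.+1, s < n.+4 & grid_parent a t = grid_dominator n.+2 j s].
Proof.
move=> a_lt t_lt; rewrite /grid_parent /grid_dominator.
have a_eq := divn_eq a 3.
have in_row j s : j < k.+1 -> s < n.+2 -> exists j' s',
    [/\ j' < k.+1, s' < n.+4 &
        ((3 * j).+1, s) = if s' < n.+2 then ((3 * j').+1, s')
                          else (3 * j', s' - n.+2)].
  by move=> jk sn; exists j, s; rewrite sn; split=> //; lia.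
have in_extra j s : j < k.+1 -> s < 2 -> exists j' s',
    [/\ j' < k.+1, s' < n.+4 &
        (3 * j, s) = if s' < n.+2 then ((3 * j').+1, s')
                     else (3 * j', s' - n.+2)].
  move=> jk s2; exists j, (n.+2 + s).
  have -> : (n.+2 + s < n.+2) = false by lia.
  by rewrite addKn; split=> //; lia.
case r: (a %% 3) a_eq => [|[|r']] a_eq; case: t t_lt => [|t'] t_lt.
- by rewrite (_ : a = 3 * (a %/ 3)); [apply: in_extra|]; lia.
- by rewrite (_ : a.+1 = (3 * (a %/ 3)).+1); [apply: in_row|]; lia.
- by rewrite (_ : a.-1 = 3 * (a %/ 3)); [apply: in_extra|]; lia.
- by rewrite (_ : a = (3 * (a %/ 3)).+1); [apply: in_row|]; lia.
- by rewrite (_ : a.-1 = (3 * (a %/ 3)).+1); [apply: in_row|]; lia.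
- by rewrite (_ : a.-1 = (3 * (a %/ 3)).+1); [apply: in_row|]; lia.
Qed.

Lemma dom_t_grid_le k n :
  dom_t (cart_prod (path_graph (3 * k).+2) (path_graph n.+2)) <= k.+1 * n.+4.
Proof.
pose vtx (p : nat * nat) : 'I_(3 * k).+2 * 'I_n.+2 := (inord p.1, inord p.2).
pose f (v : cart_prod (path_graph (3 * k).+2) (path_graph n.+2)) :=
  vtx (grid_parent v.1 v.2).
have f1 v : (f v).1 = (grid_parent v.1 v.2).1 :> nat.
  by rewrite inordK //; case: (@grid_parent_lt k n v.1 v.2).
have f2 v : (f v).2 = (grid_parent v.1 v.2).2 :> nat.
  by rewrite inordK //; case: (@grid_parent_lt k n v.1 v.2).
apply: leq_trans (dom_t_le_parent _ f _ _) _.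
- move=> v; rewrite /= /cart_adj /= /path_adj -!val_eqE /= f1 f2.
  exact: grid_parent_adj.
- move=> v; have := grid_parent_no_swap v.1 v.2.
  apply: contraNneq => ffv.
  by rewrite -f1 -f2 [X in X == _]surjective_pairing -f1 -f2 ffv.
pose g (x : 'I_k.+1 * 'I_n.+4) := vtx (grid_dominator n.+2 x.1 x.2).
have sub_fg : f @: setT \subset g @: setT.
  apply/subsetP=> _ /imsetP[v _ ->].
  have [j [s [jk sn E]]] :=
    @grid_parent_dominator k n v.1 v.2 (ltn_ord _) (ltn_ord _).
  by apply/imsetP; exists (Ordinal jk, Ordinal sn); rewrite // /f E.
apply: leq_trans (subset_leq_card sub_fg) _.
by apply: leq_trans (leq_imset_card _ _) _; rewrite cardsT card_prod !card_ord.
Qed.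

Local Open Scope ring_scope.

Theorem corollary4p6 (m n : nat) (hm : (3 <= m)%N) (hmn : (m <= n)%N)
    (hmod : m = 2 %[mod 3]) :
  (dom_t (cart_prod (path_graph m) (path_graph n)))%:R
    <= ((m%:R + 1) * n%:R) / 3%:R + (2%:R * (m%:R + 1)) / 3%:R :> rat.
Proof.
have [k mE] : exists k, m = (3 * k).+2 by exists (m %/ 3)%N; lia.
case: n hmn => [|[|n]] hmn; try lia.
rewrite {}mE in hm hmn hmod *.
have -> : ((3 * k).+2%:R + 1) * n.+2%:R / 3%:R
    + 2%:R * ((3 * k).+2%:R + 1) / 3%:R = (k.+1 * n.+4)%:R :> rat.
  by rewrite natrM -!natr1 natrM; field.
by rewrite ler_nat dom_t_grid_le.
Qed.
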